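(* Consider the problem of maximizing $\sum_{i,j:\,e^R_{ij}\in E^R}U_{ij}f^R_{ij}$ over all real-valued circulation flows $f$ in a social-request graph $G=(V,E^S\cup E^R)$ (divisible sensing service), where all capacities $R_{ij},S_{ij}$ and all utilities $U_{ij}$ are rational. Let $\overline U=\max_{e^R_{ij}\in E^R}U_{ij}$, $\overline R=\max_{e^R_{ij}\in E^R}R_{ij}$, and let $K$ be a positive integer such that $KR_{ij}$, $KS_{ij}$, $KU_{ij}$ are integers for all edges. Then the cycle-canceling algorithm described in the context, applied to the problem with all capacities and utilities multiplied by $K$ (with the resulting flow divided by $K$), computes the optimal flow and has running time \[O\bigl(|V|\,|E^R|\,(|E^R|+|E^S|)\,\overline R\,\overline U\,K^2\bigr).\]
   Context: $V$ is a finite set of users. The request graph $(V,E^R)$ is directed, has no loops, and has at most one request edge $e^R_{ij}$ from $i$ to $j$, with capacity $R_{ij}>0$ and utility per unit flow $U_{ij}$. The social graph $(V,E^S)$ is directed, has no loops, and has at most one social edge $e^S_{ij}$ from $i$ to $j$, with capacity $S_{ij}$. Convention: social edges come in pairs, i.e. $e^S_{ij}\in E^S$ iff $e^S_{ji}\in E^S$; a missing reverse edge is represented by an edge of capacity $0$, and all other social capacities are positive. $G=(V,E^S\cup E^R)$ is the directed multigraph containing all these edges. A circulation flow in $G$ is $f=(f^S_{ij},f^R_{ij})$ with $-S_{ji}\le f^S_{ij}\le S_{ij}$ and $f^S_{ji}=-f^S_{ij}$ for all $e^S_{ij}\in E^S$; $0\le f^R_{ij}\le R_{ij}$ for all $e^R_{ij}\in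 E^R$; and, for all $i\in V$, $\sum_{j:e^R_{ij}\in E^R}f^R_{ij}+\sum_{j:e^S_{ij}\in E^S}f^S_{ij}=\sum_{j:e^R_{ji}\in E^R}f^R_{ji}$. Residual graph $G_f$ of a circulation flow $f$: a weighted directed multigraph on $V$. Each request edge $e^R_{ij}$ gives a forward edge $i\to j$ of capacity $R_{ij}-f^R_{ij}$ and weight $U_{ij}$, and a backward edge $j\to i$ of capacity $f^R_{ij}$ and weight $-U_{ij}$. Each social edge $e^S_{ij}$ gives an edge $i\to j$ of capacity $S_{ij}-f^S_{ij}$ and weight $0$. Edges of capacity zero are omitted. The weight of a cycle is the sum of its edge weights; its residual capacity is the minimum capacity of its edges. Augmenting $f$ with a balanced flow of value $r$ along a directed cycle $c$ of $G_f$ means: for each forward request edge of $c$ increase the corresponding $f^R_{ij}$ by $r$; for each backward request edge of $c$ decrease the corresponding $f^R_{ij}$ by $r$; for each social edge $i\to j$ of $c$ increase $f^S_{ij}$ by $r$ and decrease $f^S_{ji}$ by $r$. Cycle-canceling algorithm: start with the zero flow $f$. While $G_f$ contains a (simple) directed cycle of positive weight, find such a cycle $c$, compute its residual capacity $r_c$, and augment $f$ with a balanced flow of value $r_c$ along $c$. Return $f$. Testing for and finding a positive-weight cycle is done by a Bellman–Ford-type procedure that finds one whenever it exists, in time $O(|V|(|E^S|+|E^R|))$. Running time counts arithmetic operations and comparisons as unit cost.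
   Formalization: The running-time bound is stated only when the maximum utility is positive; if it is zero or negative the claimed bound is at most 0 while the algorithm takes a positive number of steps. Optimality is proved without this condition. *)

(* Defs.v *)
From HB Require Import structures.
From mathcomp Require Import all_boot all_order all_algebra.
From mathcomp Require Import reals.

Set Implicit Arguments.
Unset Strict Implicit.
Unset Printing Implicit Defensive.

Import Order.TTheory GRing.Theory Num.Theory.
Local Open Scope ring_scope.

(* Capacities, utilities and flows are total functions on pairs of users, but
   only their values on the edge sets [request] and [social] are meaningful;
   the other values are junk. *)
Record network (R : Type) (V : finType) : Type := Network {
  request : {set V * V};
  social : {set V * V};
  reqcap : V -> V -> R;
  util : V -> V -> R;
  soccap : V -> V -> R }.

Record flow (R : Type) (V : finType) : Type := Flow {
  socflow : V -> V -> R;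
  reqflow : V -> V -> R }.

(* The last clause rules out pairs of social edges that are both missing: a
   zero capacity only ever stands for the missing reverse of an edge. *)
Definition well_formed (R : realType) (V : finType) (N : network R V) : Prop :=
  [/\ forall i, (i, i) \notin request N,
      forall i j, (i, j) \in request N -> 0 < reqcap N i j,
      forall i, (i, i) \notin social N,
      forall i j, ((i, j) \in social N) = ((j, i) \in social N) &
      forall i j, (i, j) \in social N ->
        [/\ 0 <= soccap N i j, 0 <= soccap N j i &
            0 < soccap N i j \/ 0 < soccap N j i]].

Definition on_data (R : Type) (V : finType) (P : R -> Prop)
    (N : network R V) : Prop :=
  (forall i j, (i, j) \in request N -> P (reqcap N i j) /\ P (util N i j)) /\
  (forall i j, (i, j) \in social N -> P (soccap N i j)).

Definition is_rational (R : realType) (x : R) : Prop :=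
  exists q : rat, x = ratr q.

Definition is_circulation (R : realType) (V : finType)
    (N : network R V) (f : flow R V) : Prop :=
  [/\ forall i j, (i, j) \in social N ->
        - soccap N j i <= socflow f i j <= soccap N i j,
      forall i j, (i, j) \in social N -> socflow f j i = - socflow f i j,
      forall i j, (i, j) \in request N -> 0 <= reqflow f i j <= reqcap N i j &
      forall i,
        \sum_(j | (i, j) \in request N) reqflow f i j
          + \sum_(j | (i, j) \in social N) socflow f i j
        = \sum_(j | (j, i) \in request N) reqflow f j i].

Definition utility (R : realType) (V : finType)
    (N : network R V) (f : flow R V) : R :=
  \sum_(e in request N) util N e.1 e.2 * reqflow f e.1 e.2.

Definition is_optimal (R : realType) (V : finType)
    (N : network R V) (f : flow R V) : Prop :=
  is_circulation N f /\
  forall g, is_circulation N g -> utility N g <= utility N f.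

Definition is_maximum (R : realType) (V : finType)
    (E : {set V * V}) (w : V -> V -> R) (m : R) : Prop :=
  (exists i j, (i, j) \in E /\ w i j = m) /\
  (forall i j, (i, j) \in E -> w i j <= m).

(* [Forward i j] and [Backward i j] both come from the request edge from i to j;
   the latter goes from j to i. *)
Inductive arc (V : Type) : Type :=
  | Forward of V & V
  | Backward of V & V
  | Social of V & V.

Section Residual.
Context (R : realType) (V : finType) (N : network R V) (f : flow R V).

Definition arc_src (a : arc V) : V :=
  match a with Forward i _ => i | Backward _ j => j | Social i _ => i end.

Definition arc_tgt (a : arc V) : V :=
  match a with Forward _ j => j | Backward i _ => i | Social _ j => j end.

Definition arc_edge (a : arc V) : bool :=
  match a with
  | Forward i j | Backward i j => (i, j) \in request N
  | Social i j => (i, j) \in social N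
  end.

Definition arc_capacity (a : arc V) : R :=
  match a with
  | Forward i j => reqcap N i j - reqflow f i j
  | Backward i j => reqflow f i j
  | Social i j => soccap N i j - socflow f i j
  end.

Definition arc_weight (a : arc V) : R :=
  match a with
  | Forward i j => util N i j
  | Backward i j => - util N i j
  | Social _ _ => 0
  end.

Definition in_residual (a : arc V) : bool :=
  arc_edge a && (arc_capacity a != 0).

Definition residual_cycle (c : seq (arc V)) : bool :=
  [&& (0 < size c)%N, all in_residual c,
      cycle (fun a b => arc_tgt a == arc_src b) c & uniq (map arc_src c)].

Definition cycle_weight (c : seq (arc V)) : R := \sum_(a <- c) arc_weight a.

Definition positive_cycle (c : seq (arc V)) : bool :=
  residual_cycle c && (0 < cycle_weight c).

End Residual.

(* A computation returns its result together with its number of steps. *)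
Definition timed (A : Type) : Type := (A * nat)%type.

Definition tret (A : Type) (x : A) : timed A := (x, 0%N).

Definition tbind (A B : Type) (m : timed A) (k : A -> timed B) : timed B :=
  ((k m.1).1, (m.2 + (k m.1).2)%N).

Notation "'let*' x := m 'in' k" := (tbind m (fun x => k))
  (at level 200, x name, m at level 100, k at level 200,
   format "'[v' 'let*'  x  :=  m  'in' '/' k ']'").

(* One unit-cost step.  It is only ever applied to an expression that takes at
   most one arithmetic operation, one comparison, or one write into a table. *)
Definition step (A : Type) (x : A) : timed A := (x, 1%N).

Fixpoint tfold (A B : Type) (g : B -> A -> timed B) (b : B) (s : seq A) :
    timed B :=
  if s is a :: s' then let* b' := g b a in tfold g b' s' else tret b.

Section Programs.
Context (R : realType) (V : finType).
Implicit Types (N : network R V) (f : flow R V) (E : {set V * V}).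

Definition update (h : V -> V -> R) (i j : V) (x : R) : V -> V -> R :=
  fun k l => if (k == i) && (l == j) then x else h k l.

Definition tabulate E (g : V -> V -> timed R) : timed (V -> V -> R) :=
  tfold (fun h e => let* x := g e.1 e.2 in step (update h e.1 e.2 x))
        (fun _ _ => 0) (enum E).

Definition scale_network (K : nat) N : timed (network R V) :=
  let* r := tabulate (request N) (fun i j => step (K%:R * reqcap N i j)) in
  let* u := tabulate (request N) (fun i j => step (K%:R * util N i j)) in
  let* s := tabulate (social N) (fun i j => step (K%:R * soccap N i j)) in
  tret (Network (request N) (social N) r u s).

Definition divide_flow (K : nat) N f : timed (flow R V) :=
  let* s := tabulate (social N) (fun i j => step (socflow f i j / K%:R)) in
  let* r := tabulate (request N) (fun i j => step (reqflow f i j / K%:R)) in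
  tret (Flow s r).

Definition zero_flow N : timed (flow R V) :=
  let* s := tabulate (social N) (fun _ _ => tret 0) in
  let* r := tabulate (request N) (fun _ _ => tret 0) in
  tret (Flow s r).

Definition residual_capacity N f (c : seq (arc V)) : timed R :=
  if c is a :: c' then
    let* r0 := step (arc_capacity N f a) in
    tfold (fun r b =>
             let* x := step (arc_capacity N f b) in step (Num.min r x)) r0 c'
  else tret 0.

Definition augment_arc (r : R) f (a : arc V) : timed (flow R V) :=
  match a with
  | Forward i j =>
      let* x := step (reqflow f i j + r) in
      let* h := step (update (reqflow f) i j x) in
      tret (Flow (socflow f) h)
  | Backward i j =>
      let* x := step (reqflow f i j - r) in
      let* h := step (update (reqflow f) i j x) in
      tret (Flow (socflow f) h)
  | Social i j =>
      let* x := step (socflow f i j + r) in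
      let* y := step (socflow f j i - r) in
      let* h := step (update (socflow f) i j x) in
      let* h' := step (update h j i y) in
      tret (Flow h' (reqflow f))
  end.

Definition augment N f (c : seq (arc V)) : timed (flow R V) :=
  let* r := residual_capacity N f c in tfold (augment_arc r) f c.

End Programs.

(* A procedure that tests for, and finds, a positive-weight cycle in the
   residual graph; [None] means that it reports that there is none. *)
Definition cycle_finder (R : realType) : Type :=
  forall V : finType, network R V -> flow R V -> timed (option (seq (arc V))).

Definition finder_correct (R : realType) (find : cycle_finder R) : Prop :=
  forall (V : finType) (N : network R V) (f : flow R V),
    well_formed N -> is_circulation N f ->
    match (find V N f).1 return Prop with
    | Some c => positive_cycle N f c
    | None => forall c, ~~ positive_cycle N f c
    end.

Definition finder_fast (R : realType) (find : cycle_finder R) : Prop :=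
  exists b : nat, forall (V : finType) (N : network R V) (f : flow R V),
    well_formed N -> is_circulation N f ->
    ((find V N f).2 <= b * (#|V| * (#|social N| + #|request N|)))%N.

(* [cancel_loop find N f g t]: the loop, entered with the flow f, terminates
   with the flow g after t steps. *)
Inductive cancel_loop (R : realType) (find : cycle_finder R) (V : finType)
    (N : network R V) : flow R V -> flow R V -> nat -> Prop :=
  | LoopDone f t :
      find V N f = (None, t) -> cancel_loop find N f f t
  | LoopNext f c t1 f' t2 g t3 :
      find V N f = (Some c, t1) -> augment N f c = (f', t2) ->
      cancel_loop find N f' g t3 ->
      cancel_loop find N f g (t1 + t2 + t3).

Definition cycle_canceling (R : realType) (find : cycle_finder R)
    (V : finType) (N : network R V) (f : flow R V) (t : nat) : Prop :=
  exists f0 t0 t1,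
    [/\ zero_flow N = (f0, t0), cancel_loop find N f0 f t1 & t = (t0 + t1)%N].

Definition scaled_cycle_canceling (R : realType) (find : cycle_finder R)
    (V : finType) (K : nat) (N : network R V) (f : flow R V) (t : nat) : Prop :=
  exists N' t1 g t2 t3,
    [/\ scale_network K N = (N', t1), cycle_canceling find N' g t2,
        divide_flow K N g = (f, t3) & t = (t1 + t2 + t3)%N].

(* Main.v *)
Require Import Defs.
From HB Require Import structures.
From mathcomp Require Import all_boot all_order all_algebra.
From mathcomp Require Import classical_sets reals.
From mathcomp Require Import ring lra zify.

(** While a positive cycle exists, scaled data and flows are integral, so the
    cycle has weight and residual capacity at least 1 and cancelling it gains at
    least 1 unit of utility.  As the scaled utility never exceeds
    |E^R| (K Rbar) (K Ubar), this bounds the number of rounds, each of which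
    costs O(|V| (|E^R| + |E^S|)).

    When no simple positive cycle is left, cutting loops out of residual walks
    does not decrease their weight, so the weights of all walks are bounded.
    The supremum p v of the weights of the walks ending at v then satisfies
    p(src a) + weight(a) <= p(tgt a) on every residual arc a, and such a
    potential is a dual certificate of optimality. *)

Set Implicit Arguments.
Unset Strict Implicit.
Unset Printing Implicit Defensive.

Import Order.TTheory GRing.Theory Num.Theory.
(* [path.arc] would otherwise hide the arcs of the residual graph. *)
Import Defs.
Local Open Scope ring_scope.

(** * Decidable equality of arcs *)

Definition arc_code (V : Type) (a : arc V) : (V * V) + ((V * V) + (V * V)) :=
  match a with
  | Forward i j => inl (i, j)
  | Backward i j => inr (inl (i, j))
  | Social i j => inr (inr (i, j))
  end.

Definition arc_decode (V : Type) (x : (V * V) + ((V * V) + (V * V))) : arc V :=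
  match x with
  | inl (i, j) => Forward i j
  | inr (inl (i, j)) => Backward i j
  | inr (inr (i, j)) => Social i j
  end.

Lemma arc_codeK (V : Type) : cancel (@arc_code V) (@arc_decode V).
Proof. by case. Qed.

HB.instance Definition _ (V : eqType) :=
  Equality.copy (arc V) (can_type (@arc_codeK V)).

Lemma eq_Forward (V : eqType) (i j k l : V) :
  (Forward i j == Forward k l) = ((i, j) == (k, l)).
Proof. by apply/eqP/eqP => [[-> ->]|[-> ->]]. Qed.

Lemma eq_Backward (V : eqType) (i j k l : V) :
  (Backward i j == Backward k l) = ((i, j) == (k, l)).
Proof. by apply/eqP/eqP => [[-> ->]|[-> ->]]. Qed.

Lemma eq_Social (V : eqType) (i j k l : V) :
  (Social i j == Social k l) = ((i, j) == (k, l)).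
Proof. by apply/eqP/eqP => [[-> ->]|[-> ->]]. Qed.

(** * Sums of indicators and of potentials over edge sets *)

Section EdgeSums.
Context (R : pzRingType) (V : finType) (E : {set V * V}).

Lemma sum_delta (F : V * V -> R) (x : V * V) :
  x \in E -> \sum_(e in E) F e * (x == e)%:R = F x.
Proof.
move=> xE; rewrite (bigD1 x) //= eqxx mulr1 big1 ?addr0 // => e /andP[_ nex].
by rewrite eq_sym (negPf nex) mulr0.
Qed.

Lemma sum_delta_row (k l i : V) :
  (k, l) \in E -> \sum_(j | (i, j) \in E) ((k, l) == (i, j))%:R = (k == i)%:R :> R.
Proof.
move=> klE; have [<-|nki] := eqVneq k i.
  rewrite (bigD1 l) //= eqxx big1 ?addr0 // => j /andP[_ njl].
  by rewrite xpair_eqE [l == j]eq_sym (negPf njl) andbF.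
by rewrite big1 // => j _; rewrite xpair_eqE (negPf nki).
Qed.

Lemma sum_delta_col (k l i : V) :
  (k, l) \in E -> \sum_(j | (j, i) \in E) ((k, l) == (j, i))%:R = (l == i)%:R :> R.
Proof.
move=> klE; have [<-|nli] := eqVneq l i.
  rewrite (bigD1 k) //= eqxx big1 ?addr0 // => j /andP[_ njk].
  by rewrite xpair_eqE [k == j]eq_sym (negPf njk).
by rewrite big1 // => j _; rewrite xpair_eqE (negPf nli) andbF.
Qed.

Lemma sum_rows (p : V -> R) (F : V -> V -> R) :
  \sum_i p i * \sum_(j | (i, j) \in E) F i j = \sum_(e in E) p e.1 * F e.1 e.2.
Proof.
under eq_bigr do rewrite mulr_sumr.
rewrite pair_big_dep /=; apply: eq_bigl => -[i j] //.
Qed.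

Lemma sum_cols (p : V -> R) (F : V -> V -> R) :
  \sum_i p i * \sum_(j | (j, i) \in E) F j i = \sum_(e in E) p e.2 * F e.1 e.2.
Proof.
under eq_bigr do rewrite mulr_sumr.
rewrite (exchange_big_dep predT) //= pair_big_dep /=.
by apply: eq_bigl => -[i j].
Qed.

End EdgeSums.

(** * Values and step counts of folds and tables *)

Section TimedFolds.
Context (A B : Type) (g : B -> A -> timed B).

Lemma tfold_val (b : B) (s : seq A) :
  (tfold g b s).1 = foldl (fun b a => (g b a).1) b s.
Proof. by elim: s b => //= a s IH b; rewrite IH. Qed.

Lemma tfold_steps (m : nat) (b : B) (s : seq A) :
  (forall b a, ((g b a).2 <= m)%N) -> ((tfold g b s).2 <= m * size s)%N.
Proof.
move=> gm; elim: s b => //= a s IH b.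
by rewrite mulnS leq_add.
Qed.

End TimedFolds.

Section Tabulate.
Context (R : realType) (V : finType).

Lemma tabulate_val (E : {set V * V}) (g : V -> V -> timed R) (i j : V) :
  (tabulate E g).1 i j = if (i, j) \in E then (g i j).1 else 0.
Proof.
rewrite tfold_val -mem_enum.
(* The fold overwrites its initial table, so the default value 0 is generalised to an arbitrary [h0]
   before the induction. *)
set h0 := (X in foldl _ X _); rewrite -[0]/(h0 i j); move: h0.
elim: (enum E) => [|e s IH] h //=.
rewrite IH in_cons /= /update; case: ifP => _; first by rewrite orbT.
rewrite orbF; case: e => k l /=; rewrite xpair_eqE.
by case: andP => [[/eqP -> /eqP ->]|].
Qed.

Lemma tabulate_steps (E : {set V * V}) (g : V -> V -> timed R) (m : nat) :
  (forall i j, ((g i j).2 <= m)%N) -> ((tabulate E g).2 <= m.+1 * #|E|)%N.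
Proof.
move=> gm; rewrite cardE; apply: tfold_steps => h e /=.
by rewrite addn1 ltnS.
Qed.

End Tabulate.

(** * Residual arcs, residual capacities and the arithmetic of augmentation *)

Section Residual.
Context (R : realType) (V : finType) (N : network R V).
Implicit Types (f g : flow R V) (a : arc V) (c : seq (arc V)).

(** Signed incidence: the change on the request edge [(i, j)] per unit of flow sent along [a]. It
    makes augmentation linear in the arcs. *)
Definition reqdelta a (i j : V) : R :=
  (a == Forward i j)%:R - (a == Backward i j)%:R.

Definition socdelta a (i j : V) : R :=
  (a == Social i j)%:R - (a == Social j i)%:R.

Lemma socdeltaC a i j : socdelta a j i = - socdelta a i j.
Proof. by rewrite opprB. Qed.

Definition integral_flow f : Prop :=
  (forall i j, (i, j) \in request N -> reqflow f i j \is a Num.int) /\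
  (forall i j, (i, j) \in social N -> socflow f i j \is a Num.int).

Lemma intr_ge1 (x : R) : x \is a Num.int -> 0 < x -> 1 <= x.
Proof.
by move=> xi x0; rewrite -(gtr0_norm x0) norm_intr_ge1 // gt_eqF.
Qed.

Lemma sum_mem_uniq c a :
  uniq c -> \sum_(b <- c) (b == a)%:R = (a \in c)%:R :> R.
Proof.
by move=> cu; rewrite -natr_sum -count_uniq_mem // -sum1_count [X in _ = X%:R]big_mkcond.
Qed.

Hypothesis wfN : well_formed N.

Lemma social_neq i j : (i, j) \in social N -> i != j.
Proof.
by case: wfN => _ _ nl _ _; apply: contraTneq => <-; exact: nl.
Qed.

Lemma socialC i j : ((i, j) \in social N) = ((j, i) \in social N).
Proof. by case: wfN. Qed.

Lemma arc_capacity_ge0 f a :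
  is_circulation N f -> arc_edge N a -> 0 <= arc_capacity N f a.
Proof.
case=> fs _ fr _; case: a => i j /= ij.
- by have /andP[] := fr _ _ ij; rewrite subr_ge0.
- by have /andP[] := fr _ _ ij.
- by have /andP[] := fs _ _ ij; rewrite subr_ge0.
Qed.

Lemma arc_capacity_gt0 f a :
  is_circulation N f -> in_residual N f a -> 0 < arc_capacity N f a.
Proof.
by move=> fc /andP[ae a0]; rewrite lt_def a0 arc_capacity_ge0.
Qed.

Section Int.
Hypothesis intN : on_data (fun x : R => x \is a Num.int) N.

Lemma arc_capacity_int f a :
  integral_flow f -> arc_edge N a -> arc_capacity N f a \is a Num.int.
Proof.
case: intN => ir is' [fr fs]; case: a => i j /= ij.
- by rewrite rpredB ?fr //; case: (ir _ _ ij).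
- exact: fr.
- by rewrite rpredB ?fs ?is'.
Qed.

Lemma arc_weight_int a : arc_edge N a -> arc_weight N a \is a Num.int.
Proof.
case: intN => ir _; case: a => i j /= ij; rewrite ?rpredN ?rpred0 //;
  by case: (ir _ _ ij).
Qed.

End Int.

(** The minimum is attained, hence inherits any [P] shared by all capacities on [c]. Positivity and
    integrality of the augmentation value are both obtained this way. *)
Lemma residual_capacityP f c (P : R -> Prop) :
  (0 < size c)%N -> {in c, forall a, P (arc_capacity N f a)} ->
  P (residual_capacity N f c).1 /\
  {in c, forall a, (residual_capacity N f c).1 <= arc_capacity N f a}.
Proof.
case: c => // b c _ Pc; rewrite /= tfold_val /=.
set r0 := arc_capacity N f b.
have Pr0 : P r0 by apply: Pc; rewrite mem_head.
have [] : [/\ P (foldl (fun r a => Num.min r (arc_capacity N f a)) r0 c),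
   foldl (fun r a => Num.min r (arc_capacity N f a)) r0 c <= r0 &
   {in c, forall a, foldl (fun r a => Num.min r (arc_capacity N f a)) r0 c
      <= arc_capacity N f a}].
  have {}Pc : {in c, forall a, P (arc_capacity N f a)}.
    by move=> a ac; apply: Pc; rewrite in_cons ac orbT.
  elim: c r0 Pr0 Pc => [|a c IH] r Pr Pc //=.
  have [||P1 le1 le2] := IH (Num.min r (arc_capacity N f a)).
  - by rewrite /Num.min; case: ifP => // _; apply: Pc; rewrite mem_head.
  - by move=> d dc; apply: Pc; rewrite in_cons dc orbT.
  split=> // [|d]; first by rewrite (le_trans le1) // ge_min lexx.
  rewrite in_cons => /predU1P[->|]; last exact: le2.
  by rewrite (le_trans le1) // ge_min lexx orbT.
move=> P1 le1 le2; split=> // a.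
by rewrite in_cons => /predU1P[->|/le2].
Qed.

Lemma residual_capacity_steps f c :
  ((residual_capacity N f c).2 <= 2 * size c)%N.
Proof.
case: c => // b c /=; rewrite mulnS leq_add //.
exact: tfold_steps.
Qed.

(** Each arc costs at most 2 steps in the minimum and at most 4 in the update, the worst case being
    a social arc. *)
Lemma augment_steps f c : ((augment N f c).2 <= 6 * size c)%N.
Proof.
rewrite (mulnDl 2 4) leq_add ?residual_capacity_steps //.
by apply: tfold_steps => g [].
Qed.

(** Updates along single arcs add up, even if [c] uses an edge in both directions. Restricting [c]
    to edges of [N] excludes social loops, where the two writes of [augment_arc] would collide. *)
Lemma augment_arcs_val (r : R) f c :
  all (arc_edge N) c ->
  let f' := (tfold (augment_arc r) f c).1 in
  (forall i j, reqflow f' i j = reqflow f i j + r * \sum_(a <- c) reqdelta a i j) /\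
  (forall i j, socflow f' i j = socflow f i j + r * \sum_(a <- c) socdelta a i j).
Proof.
rewrite /= tfold_val; elim: c f => [|a c IH] f /=.
  by split=> i j; rewrite big_nil mulr0 addr0.
move=> /andP[ae /(IH (augment_arc r f a).1)[IHr IHs]].
split=> i j; rewrite ?IHr ?IHs big_cons mulrDr addrA; congr (_ + _).
  case: a ae {IHr IHs} => k l ae /=; rewrite /reqdelta /update ?eq_Forward ?eq_Backward /=.
  - rewrite subr0 xpair_eqE [i == k]eq_sym [j == l]eq_sym.
    by case: andP => [[/eqP -> /eqP ->]|_]; rewrite ?mulr1 ?mulr0 ?addr0.
  - rewrite sub0r xpair_eqE [i == k]eq_sym [j == l]eq_sym.
    by case: andP => [[/eqP -> /eqP ->]|_]; rewrite ?mulrN1 ?oppr0 ?mulr0 ?addr0.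
  - by rewrite subr0 mulr0 addr0.
case: a ae {IHr IHs} => k l ae /=; rewrite /socdelta ?subr0 ?mulr0 ?addr0 //.
have kl := social_neq ae; rewrite !eq_Social /update !xpair_eqE.
rewrite [i == k]eq_sym [j == l]eq_sym [i == l]eq_sym [j == k]eq_sym.
have [ki|ki] := eqVneq k i; have [lj|lj] := eqVneq l j;
  have [kj|kj] := eqVneq k j; have [li|li] := eqVneq l i; subst => //=;
  rewrite ?eqxx // in kl *; rewrite ?subr0 ?sub0r ?oppr0 ?mulr0 ?addr0 ?mulrN1 ?mulr1 //.
Qed.

Lemma sum_reqdelta c i j : uniq c ->
  \sum_(a <- c) reqdelta a i j = (Forward i j \in c)%:R - (Backward i j \in c)%:R.
Proof. by move=> cu; rewrite sumrB !sum_mem_uniq. Qed.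

Lemma sum_socdelta c i j : uniq c ->
  \sum_(a <- c) socdelta a i j = (Social i j \in c)%:R - (Social j i \in c)%:R.
Proof. by move=> cu; rewrite sumrB !sum_mem_uniq. Qed.

(** Local form of flow conservation: the left side is the net outflow at [i] caused by one unit of
    flow along [a]. *)
Lemma arc_balance a i : arc_edge N a ->
  \sum_(j | (i, j) \in request N) reqdelta a i j
    + \sum_(j | (i, j) \in social N) socdelta a i j
    - \sum_(j | (j, i) \in request N) reqdelta a j i
  = (arc_src a == i)%:R - (arc_tgt a == i)%:R.
Proof.
case: a => k l kl; rewrite /reqdelta /socdelta !sumrB /=.
- under eq_bigr do rewrite eq_Forward.
  under [X in _ - (X - _)]eq_bigr do rewrite eq_Forward.
  rewrite (sum_delta_row _ _ kl) (sum_delta_col _ _ kl).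
  by rewrite !big1 // !subr0 addr0.
- under [X in _ - X + _]eq_bigr do rewrite eq_Backward.
  under [X in _ - (_ - X)]eq_bigr do rewrite eq_Backward.
  rewrite (sum_delta_row _ _ kl) (sum_delta_col _ _ kl).
  by rewrite !big1 // !subr0 addr0 !sub0r opprK addrC.
- under [X in _ + (X - _)]eq_bigr do rewrite eq_Social.
  under [X in _ + (_ - X)]eq_bigr do rewrite eq_Social.
  (* Symmetry of [social N] turns the row sum over reversed edges into a column sum. *)
  under [X in _ + (_ - X)]eq_bigl do rewrite socialC.
  rewrite (sum_delta_row _ _ kl) (sum_delta_col _ _ kl).
  by rewrite !big1 // !subr0 add0r.
Qed.

(** The targets along a cycle are its sources rotated by one place, so the indicators cancel in
    total. *)
Lemma cycle_balance c (i : V) :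
  cycle (fun a b => arc_tgt a == arc_src b) c ->
  \sum_(a <- c) ((arc_src a == i)%:R - (arc_tgt a == i)%:R : R) = 0.
Proof.
have tgt_src a p : path (fun a b => arc_tgt a == arc_src b) a p ->
    map (@arc_tgt V) (belast a p) = map (@arc_src V) p.
  by elim: p a => //= b p IH a /andP[/eqP -> /IH ->].
case: c => [|a p] /=; first by rewrite big_nil.
move=> /tgt_src; rewrite belast_rcons map_rcons => e.
rewrite sumrB -(big_map _ predT (fun x => (x == i)%:R)).
rewrite -[X in _ - X](big_map _ predT (fun x => (x == i)%:R)) e big_rcons /=.
by rewrite big_cons addrC subrr.
Qed.

(** * Cancelling one residual cycle *)

Section Augment.
Context (f : flow R V) (c : seq (arc V)).
Hypotheses (fc : is_circulation N f) (cc : residual_cycle N f c).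

Let f' := (augment N f c).1.
Let r := (residual_capacity N f c).1.

Let c_edges : all (arc_edge N) c.
Proof. by case/and4P: cc => _ + _ _; apply: sub_all => a /andP[]. Qed.

Let c_uniq : uniq c.
Proof. by case/and4P: cc => _ _ _ /map_uniq. Qed.

Lemma augment_reqflow i j :
  reqflow f' i j = reqflow f i j + r * \sum_(a <- c) reqdelta a i j.
Proof. by have [-> _] := augment_arcs_val r f c_edges. Qed.

Lemma augment_socflow i j :
  socflow f' i j = socflow f i j + r * \sum_(a <- c) socdelta a i j.
Proof. by have [_ ->] := augment_arcs_val r f c_edges. Qed.

Let r_gt0 : 0 < r.
Proof.
case/and4P: cc => c0 /allP cr _ _.
have [|//] := @residual_capacityP f c (fun x => 0 < x) c0.
by move=> a /cr; exact: arc_capacity_gt0.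
Qed.

(** The maximum with 0 handles arcs off the cycle, whose capacity may have any sign. *)
Let r_le a : r * (a \in c)%:R <= Num.max 0 (arc_capacity N f a).
Proof.
case: (boolP (a \in c)) => [ac|_]; last by rewrite mulr0 le_max lexx.
case/and4P: cc => c0 _ _ _; rewrite mulr1 le_max.
have [//|_ r_min] := @residual_capacityP f c (fun=> True) c0.
by rewrite r_min ?orbT.
Qed.

Let r_le_edge a : arc_edge N a -> r * (a \in c)%:R <= arc_capacity N f a.
Proof.
by move=> ae; have := r_le a; rewrite max_r // arc_capacity_ge0.
Qed.

Let r_mem_ge0 a : 0 <= r * (a \in c)%:R.
Proof. by rewrite mulr_ge0 // ltW. Qed.

Lemma augment_circulation : is_circulation N f'.
Proof.
have [fs fa fr fb] := fc; split=> [i j ij|i j ij|i j ij|i].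
(* The terms of the two directions are bounded separately, by the slack above and the slack below,
   so both arcs may lie on [c]. *)
- rewrite augment_socflow sum_socdelta // mulrBr.
  have := r_le_edge (a := Social i j) ij.
  have /r_le_edge : arc_edge N (Social j i) by rewrite /= -socialC.
  rewrite /= fa //.
  have := r_mem_ge0 (Social i j); have := r_mem_ge0 (Social j i).
  by move=> *; apply/andP; split; lra.
- rewrite !augment_socflow fa // opprD -mulrN -sumrN; congr (_ + _ * _).
  by apply: eq_bigr => a _; rewrite socdeltaC.
- rewrite augment_reqflow sum_reqdelta // mulrBr.
  have := r_le_edge (a := Forward i j) ij.
  have /= := r_le_edge (a := Backward i j) ij.
  have := r_mem_ge0 (Forward i j); have := r_mem_ge0 (Backward i j).
  by move=> *; apply/andP; split; lra.
- under eq_bigr do rewrite augment_reqflow.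
  under [X in _ + X = _]eq_bigr do rewrite augment_socflow.
  under [RHS]eq_bigr do rewrite augment_reqflow.
  (* After exchanging sums, the change of the balance at [i] is [r] times the sum over [c] of the
     arc balances, which is 0. *)
  rewrite !big_split /= -!mulr_sumr -[RHS]/(_ + _) -fb.
  rewrite ![\sum_(j | _) \sum_(a <- c) _]exchange_big /=.
  have bal : \sum_(a <- c) ((arc_src a == i)%:R - (arc_tgt a == i)%:R : R) = 0.
    by apply: cycle_balance; case/and4P: cc.
  have : \sum_(a <- c) \sum_(j | (i, j) \in request N) reqdelta a i j
    + \sum_(a <- c) \sum_(j | (i, j) \in social N) socdelta a i j
    - \sum_(a <- c) \sum_(j | (j, i) \in request N) reqdelta a j i = 0.
    rewrite -big_split -sumrB /= -[RHS]bal; rewrite !big_seq; apply: eq_bigr => a ac.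
    exact/arc_balance/(allP c_edges).
  by move=> /subr0_eq <-; rewrite mulrDr addrACA.
Qed.

Lemma augment_utility : utility N f' = utility N f + r * cycle_weight N c.
Proof.
rewrite /utility.
under eq_bigr do rewrite augment_reqflow mulrDr.
rewrite big_split /=; congr (_ + _).
under eq_bigr do rewrite mulrCA mulr_sumr.
rewrite -mulr_sumr exchange_big /=; congr (_ * _).
rewrite /cycle_weight !big_seq; apply: eq_bigr => a /(allP c_edges).
rewrite /reqdelta; case: a => k l /= kl.
- under eq_bigr do rewrite eq_Forward subr0 -surjective_pairing.
  exact: (sum_delta (fun e => util N e.1 e.2)).
- under eq_bigr do rewrite eq_Backward sub0r -surjective_pairing mulrN.
  by rewrite sumrN; congr (- _); exact: (sum_delta (fun e => util N e.1 e.2)).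
- by rewrite big1 // => e _; rewrite subr0 mulr0.
Qed.

Section Int.
Hypotheses (intN : on_data (fun x : R => x \is a Num.int) N).
Hypothesis (intf : integral_flow f).

Let r_int : r \is a Num.int.
Proof.
case/and4P: cc => c0 _ _ _.
have [|//] := @residual_capacityP f c (fun x => x \is a Num.int) c0.
by move=> a /(allP c_edges); exact: arc_capacity_int.
Qed.

Lemma augment_integral : integral_flow f'.
Proof.
have [fr fs] := intf; split=> i j ij.
  by rewrite augment_reqflow sum_reqdelta // rpredD ?fr ?rpredM ?rpredB ?rpred_nat.
by rewrite augment_socflow sum_socdelta // rpredD ?fs ?rpredM ?rpredB ?rpred_nat.
Qed.

(** The gain [r * cycle_weight N c] is a product of two positive integers. *)
Lemma augment_utility_ge :
  0 < cycle_weight N c -> utility N f + 1 <= utility N f'.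
Proof.
move=> wc; rewrite augment_utility lerD2l.
have w1 : 1 <= cycle_weight N c.
  apply: intr_ge1 => //; rewrite /cycle_weight big_seq; apply: rpred_sum => a.
  by move=> /(allP c_edges); exact: arc_weight_int.
by rewrite -[1]mulr1 ler_pM // intr_ge1.
Qed.

End Int.
End Augment.

End Residual.

(** * Optimality of a circulation without positive residual cycles *)

Section Optimality.
Context (R : realType) (V : finType) (N : network R V).
Hypothesis wfN : well_formed N.

Lemma circulation_potential (f : flow R V) (p : V -> R) :
  is_circulation N f ->
  \sum_(e in request N) p e.1 * reqflow f e.1 e.2
    + \sum_(e in social N) p e.1 * socflow f e.1 e.2
  = \sum_(e in request N) p e.2 * reqflow f e.1 e.2.
Proof.
case=> _ _ _ fb; rewrite -!sum_rows -sum_cols -big_split /=.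
by apply: eq_bigr => i _; rewrite -mulrDr fb.
Qed.

(** Reversing every social edge exchanges the endpoints and negates the flow. *)
Lemma social_swap (f : flow R V) (p : V -> R) :
  is_circulation N f ->
  \sum_(e in social N) p e.2 * socflow f e.1 e.2
  = - \sum_(e in social N) p e.1 * socflow f e.1 e.2.
Proof.
case=> _ fa _ _; rewrite -sum_cols -sum_rows -sumrN; apply: eq_bigr => i _.
rewrite -mulrN -sumrN; congr (_ * _); under eq_bigl do rewrite socialC //.
by apply: eq_bigr => j ij; rewrite fa.
Qed.

Variable f : flow R V.
Hypothesis fc : is_circulation N f.

(* Complementary slackness: prices along which no residual arc is profitable
   certify optimality. *)
Lemma potential_optimal (p : V -> R) :
  (forall a, in_residual N f a -> p (arc_src a) + arc_weight N a <= p (arc_tgt a)) ->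
  is_optimal N f.
Proof.
move=> pP; split=> // g gc.
have [fs fa fr _] := fc; have [gs _ gr _] := gc.
(* Where [g] exceeds [f] the forward arc is residual, and where it is smaller the backward arc is.
   The potential inequality has the required sign in both cases. *)
have req_le : \sum_(e in request N) util N e.1 e.2 * (reqflow g e.1 e.2 - reqflow f e.1 e.2)
    <= \sum_(e in request N) (p e.2 - p e.1) * (reqflow g e.1 e.2 - reqflow f e.1 e.2).
  apply: ler_sum => -[i j] /= ij.
  have /andP[f0 f1] := fr _ _ ij; have /andP[g0 g1] := gr _ _ ij.
  have [lt|gt|->] := ltgtP (reqflow f i j) (reqflow g i j); last by rewrite !subrr !mulr0.
    have /pP /= : in_residual N f (Forward i j).
      by rewrite /in_residual /= ij subr_eq0 gt_eqF // (lt_le_trans lt).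
    by move=> h; apply: ler_wpM2r; [rewrite subr_ge0 ltW|lra].
  have /pP /= : in_residual N f (Backward i j).
    by rewrite /in_residual /= ij gt_eqF // (le_lt_trans g0).
  by move=> h; apply: ler_wnM2r; [rewrite subr_le0 ltW|lra].
have soc_ge : 0 <= \sum_(e in social N) (p e.2 - p e.1) * (socflow g e.1 e.2 - socflow f e.1 e.2).
  apply: sumr_ge0 => -[i j] /= ij.
  have /andP[_ g1] := gs _ _ ij; have /andP[g0 _] := gs _ _ ij.
  have ji : (j, i) \in social N by rewrite -socialC.
  have [lt|gt|->] := ltgtP (socflow f i j) (socflow g i j); last by rewrite !subrr !mulr0.
    have /pP /= : in_residual N f (Social i j).
      by rewrite /in_residual /= ij subr_eq0 gt_eqF // (lt_le_trans lt).
    by move=> h; apply: mulr_ge0; [lra|rewrite subr_ge0 ltW].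
  have /pP /= : in_residual N f (Social j i).
    rewrite /in_residual /= ji subr_eq0 gt_eqF // (fa _ _ ij).
    by rewrite ltrNl (le_lt_trans g0).
  by move=> h; apply: mulr_le0; [lra|rewrite subr_le0 ltW].
(* Let D be the sum over social edges of [p e.1] times the difference of the social flows of [g] and
   [f]. By conservation the right side of [req_le] is D, and by antisymmetry the sum in [soc_ge] is
   -2D. Hence D <= 0, and [g] has no larger utility than [f]. *)
move: req_le soc_ge.
under eq_bigr do rewrite mulrBr.
under [X in _ <= X -> _]eq_bigr do rewrite mulrBl !mulrBr.
under [X in _ -> 0 <= X -> _]eq_bigr do rewrite mulrBl !mulrBr.
rewrite !sumrB (social_swap p gc) (social_swap p fc).
have := circulation_potential p gc; have := circulation_potential p fc.
rewrite -/(utility N f) -/(utility N g); lra.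
Qed.

Fixpoint walk (u : V) (c : seq (arc V)) (v : V) : bool :=
  if c is a :: c' then [&& arc_src a == u, in_residual N f a & walk (arc_tgt a) c' v]
  else u == v.

Lemma walk_cat u c1 c2 v :
  walk u (c1 ++ c2) v <-> exists2 w, walk u c1 w & walk w c2 v.
Proof.
elim: c1 u => [|a c1 IH] u /=.
  by split=> [h|[w /eqP <-]//]; exists u.
split=> [/and3P[-> -> /IH[w w1 w2]]|[w /and3P[-> -> w1] w2]]; first by exists w.
by apply/IH; exists w.
Qed.

Lemma walk_residual u c v : walk u c v -> all (in_residual N f) c.
Proof. by elim: c u => //= a c IH u /and3P[_ -> /IH]. Qed.

Lemma closed_walk_cycle a c :
  walk (arc_src a) (a :: c) (arc_src a) -> uniq (map (@arc_src V) (a :: c)) ->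
  residual_cycle N f (a :: c).
Proof.
move=> w cu; rewrite /residual_cycle cu (walk_residual w) andbT /=.
(* The induction generalises the arc traversed last and keeps the closing arc [a] fixed. *)
case/and3P: w => _ _; elim: c {1 3}a {cu} => [|d c IH] b /=; first by rewrite andbT.
by case/and3P=> /eqP -> _ /IH ->; rewrite eqxx.
Qed.

Hypothesis no_cycle : forall c, ~~ positive_cycle N f c.

Lemma cycle_weight_cat c1 c2 :
  cycle_weight N (c1 ++ c2) = cycle_weight N c1 + cycle_weight N c2.
Proof. exact: big_cat. Qed.

(* When prepending an arc closes a simple cycle, dropping that cycle does not
   lose weight, as it is not positive. *)
Lemma walk_shortcut u c v : walk u c v ->
  exists q, [/\ walk u q v, uniq (map (@arc_src V) q) &
                cycle_weight N c <= cycle_weight N q].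
Proof.
elim: c u => [|a c IH] u /=; first by move=> uv; exists nil.
case/and3P=> /eqP au ra /IH[q [wq uq le_cq]].
rewrite -cat1s cycle_weight_cat.
have [aq|aq] := boolP (arc_src a \in map (@arc_src V) q); last first.
  exists (a :: q); split; rewrite /= ?au ?eqxx ?ra -?au ?aq //.
  by rewrite -[a :: q]cat1s cycle_weight_cat lerD2l.
(* The simple walk [q] returns to the source of [a] at the arc [b]: the arcs [a :: q1] form a simple
   cycle, and [b :: q2] is kept. *)
case/mapP: aq => b bq sab; case/splitPr: bq => q1 q2 in wq uq le_cq *.
case/walk_cat: wq => w wq1 wq2.
have bw : arc_src b = w by case/and3P: wq2 => /eqP.
exists (b :: q2); split; first by rewrite -au sab bw.
  by move: uq; rewrite map_cat cat_uniq => /and3P[].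
have cyc : residual_cycle N f (a :: q1).
  apply: closed_walk_cycle; first by rewrite /= eqxx ra sab bw.
  move: uq; rewrite map_cat cat_uniq /= sab => /and3P[-> /norP[-> _] _] //.
have := no_cycle (a :: q1); rewrite /positive_cycle cyc -leNgt /= => le0.
move: le_cq le0; rewrite cycle_weight_cat -[a :: q1]cat1s cycle_weight_cat; lra.
Qed.

Lemma arc_weight_le a :
  arc_edge N a -> arc_weight N a <= \sum_(e in request N) `|util N e.1 e.2|.
Proof.
case: a => i j /= ij; last by apply: sumr_ge0.
- by rewrite (bigD1 (i, j)) //= ler_wpDr ?ler_norm ?sumr_ge0.
- by rewrite (bigD1 (i, j)) //= ler_wpDr ?sumr_ge0 // -normrN ler_norm.
Qed.

Lemma uniq_src_size (c : seq (arc V)) :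
  uniq (map (@arc_src V) c) -> (size c <= #|V|)%N.
Proof. by move=> /card_uniqP; rewrite size_map => <-; exact: max_card. Qed.

(** After shortcutting, a walk leaves each vertex at most once, so it has at most |V| arcs. The
    bound is uniform in the walk, which makes the suprema defining the potential finite. *)
Lemma walk_weight_le u c v : walk u c v ->
  cycle_weight N c <= #|V|%:R * \sum_(e in request N) `|util N e.1 e.2|.
Proof.
case/walk_shortcut=> q [wq uq /le_trans]; apply.
have B0 : 0 <= \sum_(e in request N) `|util N e.1 e.2| by apply: sumr_ge0.
apply: (@le_trans _ _ ((size q)%:R * \sum_(e in request N) `|util N e.1 e.2|)).
  elim: q u wq {uq} => [|a q IH] u /=; first by rewrite /cycle_weight big_nil mul0r.
  case/and3P=> _ /andP[ae _] /IH le_q.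
  by rewrite /cycle_weight big_cons mulrS mulrDl mul1r lerD ?arc_weight_le.
by rewrite ler_wpM2r // ler_nat uniq_src_size.
Qed.

Lemma no_cycle_optimal : is_optimal N f.
Proof.
pose W v : set R := [set x | exists u c, walk u c v /\ x = cycle_weight N c]%classic.
have W_bound v : has_ubound (W v).
  by exists (#|V|%:R * \sum_(e in request N) `|util N e.1 e.2|) => _ [u [c [w ->]]];
    exact: walk_weight_le w.
apply: (@potential_optimal (fun v => sup (W v))) => a ra.
(* The empty walk makes the set at the source of [a] nonempty. Appending [a] to a walk ending there
   gives a walk ending at the target of [a]. *)
rewrite -lerBrDr; apply: ge_sup.
  by exists 0, (arc_src a), nil; rewrite /= eqxx /cycle_weight big_nil.
move=> _ [u [c [w ->]]]; rewrite lerBrDr; apply: ub_le_sup => //.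
exists u, (c ++ [:: a]); rewrite cycle_weight_cat /cycle_weight big_seq1; split=> //.
by apply/walk_cat; exists (arc_src a); rewrite //= !eqxx ra.
Qed.

End Optimality.

(** * Scaling of networks and flows, and the initial flow *)

Section Scaling.
Context (R : realType) (V : finType).
Implicit Types (N : network R V) (f : flow R V).

(** A relation rather than a function: it ignores the junk values off the edges, so it can be
    inverted by passing from [x] to [x^-1]. *)
Definition scaled_network (x : R) N N' : Prop :=
  [/\ request N' = request N, social N' = social N,
      forall i j, (i, j) \in request N ->
        reqcap N' i j = x * reqcap N i j /\ util N' i j = x * util N i j &
      forall i j, (i, j) \in social N -> soccap N' i j = x * soccap N i j].

Definition scaled_flow (x : R) N f f' : Prop :=
  (forall i j, (i, j) \in request N -> reqflow f' i j = x * reqflow f i j) /\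
  (forall i j, (i, j) \in social N -> socflow f' i j = x * socflow f i j).

Lemma scaled_networkV x N N' :
  x != 0 -> scaled_network x N N' -> scaled_network x^-1 N' N.
Proof.
move=> x0 [rE sE rx sx]; split=> [||i j|i j]; rewrite ?rE ?sE // => ij.
  by have [-> ->] := rx _ _ ij; rewrite !mulKf.
by rewrite sx // mulKf.
Qed.

Lemma scaled_well_formed x N N' :
  0 < x -> scaled_network x N N' -> well_formed N -> well_formed N'.
Proof.
move=> x0 [rE sE rx sx] [nr r0 ns sC s0].
rewrite /well_formed rE sE; split=> // i j ij.
  by have [-> _] := rx _ _ ij; rewrite mulr_gt0 ?r0.
have ji : (j, i) \in social N by rewrite -sC.
by rewrite (sx _ _ ij) (sx _ _ ji) !(pmulr_rge0 _ x0) !(pmulr_rgt0 _ x0); exact: s0.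
Qed.

Lemma scaled_circulation x N N' f f' :
  0 < x -> well_formed N -> scaled_network x N N' -> scaled_flow x N f f' ->
  is_circulation N f -> is_circulation N' f'.
Proof.
move=> x0 wf [rE sE rx sx] [fr fs] [c1 c2 c3 c4].
have sC := socialC wf.
rewrite /is_circulation rE sE; split=> [i j ij|i j ij|i j ij|i].
- have ji : (j, i) \in social N by rewrite -sC.
  by rewrite (sx _ _ ij) (sx _ _ ji) fs // -mulrN !ler_pM2l // c1.
- have ji : (j, i) \in social N by rewrite -sC.
  by rewrite (fs _ _ ij) (fs _ _ ji) c2 // mulrN.
- have [-> _] := rx _ _ ij; rewrite fr // pmulr_rge0 // ler_pM2l //; exact: c3.
- under eq_bigr => j ij do rewrite fr //.
  under [X in _ + X = _]eq_bigr => j ij do rewrite fs //.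
  under [RHS]eq_bigr => j ij do rewrite fr //.
  by rewrite -!mulr_sumr -mulrDr c4.
Qed.

Lemma scaled_utility x N N' f f' :
  scaled_network x N N' -> scaled_flow x N f f' ->
  utility N' f' = x ^+ 2 * utility N f.
Proof.
move=> [rE _ rx _] [fr _]; rewrite /utility rE mulr_sumr.
apply: eq_bigr => -[i j] /= ij; have [_ ->] := rx _ _ ij; rewrite fr //; ring.
Qed.

(** A competitor in [N'] is pulled back to [N] by the factor [x^-1]. Both utilities then differ by
    the positive factor [x ^+ 2], since utilities and flows scale together. *)
Lemma scaled_optimal x N N' f f' :
  0 < x -> well_formed N -> scaled_network x N N' -> scaled_flow x N f f' ->
  is_optimal N f -> is_optimal N' f'.
Proof.
move=> x0 wf sN sf [fc fopt]; split; first exact: scaled_circulation sf fc.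
move=> g' gc.
have xV0 : 0 < x^-1 by rewrite invr_gt0.
have sN' : scaled_network x^-1 N' N by apply: scaled_networkV; rewrite ?gt_eqF.
pose g := Flow (fun i j => x^-1 * socflow g' i j) (fun i j => x^-1 * reqflow g' i j).
have sg : scaled_flow x^-1 N' g' g by [].
have := fopt g (scaled_circulation xV0 (scaled_well_formed x0 sN wf) sN' sg gc).
rewrite (scaled_utility sN' sg) (scaled_utility sN sf) exprVn mulrC.
by rewrite ler_pdivrMr ?exprn_gt0 // mulrC.
Qed.

Lemma scale_network_scaled (K : nat) N :
  scaled_network K%:R N (scale_network K N).1.
Proof. by split=> // i j ij; rewrite /= !tabulate_val ij. Qed.

(** Each entry costs one multiplication and one write, in two tables over request edges and one over
    social edges. *)
Lemma scale_network_steps (K : nat) N :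
  ((scale_network K N).2 <= 4 * #|request N| + 2 * #|social N|)%N.
Proof.
rewrite /= addn0 addnA (mulnDl 2 2).
by rewrite !leq_add //; apply: tabulate_steps.
Qed.

Lemma divide_flow_scaled (K : nat) N f :
  scaled_flow K%:R^-1 N f (divide_flow K N f).1.
Proof. by split=> i j ij; rewrite /= tabulate_val ij /= mulrC. Qed.

Lemma divide_flow_steps (K : nat) N f :
  ((divide_flow K N f).2 <= 2 * (#|request N| + #|social N|))%N.
Proof.
rewrite /= addn0 addnC mulnDr.
by rewrite leq_add //; apply: tabulate_steps.
Qed.

Lemma zero_flow_steps N : ((zero_flow N).2 <= #|request N| + #|social N|)%N.
Proof.
rewrite /= addn0 addnC -[#|request N|]mul1n -[#|social N|]mul1n.
by rewrite leq_add //; apply: tabulate_steps.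
Qed.

Lemma zero_flow_val N i j :
  reqflow (zero_flow N).1 i j = 0 /\ socflow (zero_flow N).1 i j = 0.
Proof. by rewrite /= !tabulate_val /=; split; case: ifP. Qed.

Lemma zero_flow_circulation N : well_formed N -> is_circulation N (zero_flow N).1.
Proof.
move=> wf; have [_ r0 _ sC s0] := wf.
split=> [i j ij|i j ij|i j ij|i].
- by have [_ ->] := zero_flow_val N i j; have [? ? _] := s0 _ _ ij; rewrite oppr_le0; apply/andP.
- by have [_ ->] := zero_flow_val N i j; have [_ ->] := zero_flow_val N j i; rewrite oppr0.
- by have [-> _] := zero_flow_val N i j; rewrite lexx ltW ?r0.
- by rewrite !big1 ?addr0 // => j _; case: (zero_flow_val N i j); case: (zero_flow_val N j i).
Qed.

Lemma zero_flow_utility N : utility N (zero_flow N).1 = 0.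
Proof.
by apply: big1 => -[i j] _; have [-> _] := zero_flow_val N i j; rewrite mulr0.
Qed.

Lemma zero_flow_integral N : integral_flow N (zero_flow N).1.
Proof. by split=> i j _; have [e1 e2] := zero_flow_val N i j; rewrite ?e1 ?e2 rpred0. Qed.

End Scaling.

(** * Termination and cost of the cancelling loop *)

Section CancelLoop.
Context (R : realType) (find : cycle_finder R) (b : nat).
Hypothesis find_correct : finder_correct find.
Hypothesis find_fast : forall (V : finType) (N : network R V) (f : flow R V),
  well_formed N -> is_circulation N f ->
  ((find N f).2 <= b * (#|V| * (#|social N| + #|request N|)))%N.

Context (V : finType) (N : network R V).
Hypotheses (wfN : well_formed N) (intN : on_data (fun x : R => x \is a Num.int) N).

(** Cost of one round: the search, then at most 6 steps per arc of a simple cycle, which has at most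
    |V| arcs. *)
Let round := (b * (#|V| * (#|social N| + #|request N|)) + 6 * #|V|)%N.

(* An integral flow gains at least 1 per round, so n bounds the number of
   remaining rounds. *)
Lemma cancel_loop_terminates (n : nat) (f : flow R V) :
  is_circulation N f -> integral_flow N f ->
  (forall g, is_circulation N g -> utility N g < utility N f + n%:R) ->
  exists g t k, [/\ cancel_loop find N f g t, is_optimal N g,
    (t <= k.+1 * round)%N & utility N f + k%:R <= utility N g].
Proof.
elim: n f => [|n IH] f fc fi bnd.
  (* With no rounds left, the bound applied to [f] itself is contradictory. *)
  by have := bnd f fc; rewrite addr0 ltxx.
have := find_correct wfN fc; have := find_fast wfN fc.
case ef : (find N f) => [[c|] t1] /= t1_le.
  case/andP=> cc wc; case ea : (augment N f c) => [f' t2].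
  have ef' : f' = (augment N f c).1 by rewrite ea.
  have uf' : utility N f + 1 <= utility N f'.
    by rewrite ef'; exact: augment_utility_ge.
  have [||g gc|g [t3 [k [lg og t3_le ug]]]] := IH f'.
  - by rewrite ef'; exact: augment_circulation.
  - by rewrite ef'; exact: augment_integral.
  - by have := bnd g gc; rewrite -natr1; lra.
  exists g, (t1 + t2 + t3)%N, k.+1; split=> //.
  - exact: LoopNext ef ea lg.
  - rewrite [(k.+2 * _)%N]mulSn leq_add // leq_add //.
    have -> : t2 = (augment N f c).2 by rewrite ea.
    rewrite (leq_trans (augment_steps _ _ _)) // leq_mul2l uniq_src_size //.
    by case/and4P: cc.
  - by rewrite -natr1; lra.
(* The final unsuccessful search also costs a round, whence [k.+1] rounds for [k] augmentations. *)
move=> nc; exists f, t1, 0%N; split; last by rewrite addr0.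
- exact: LoopDone.
- exact: no_cycle_optimal.
- by rewrite mul1n /round (leq_trans t1_le) // leq_addr.
Qed.

(** An a priori bound that makes sense even without request edges, where no maxima exist. It serves
    only to prove termination. *)
Lemma utility_le (f : flow R V) : is_circulation N f ->
  utility N f <= \sum_(e in request N) `|util N e.1 e.2| * reqcap N e.1 e.2.
Proof.
case=> _ _ fr _; apply: ler_sum => -[i j] /= ij; have /andP[f0 f1] := fr _ _ ij.
by rewrite (le_trans (ler_wpM2r f0 (ler_norm _))) // ler_wpM2l.
Qed.

(** The number [k] of augmentations is bounded by the final utility, so that any later bound on the
    utility becomes a bound on the time. *)
Lemma cycle_canceling_terminates :
  exists g t k, [/\ cycle_canceling find N g t, is_optimal N g,
    (t <= #|request N| + #|social N| + k.+1 * round)%N & k%:R <= utility N g].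
Proof.
set f0 := (zero_flow N).1.
set B := \sum_(e in request N) `|util N e.1 e.2| * reqcap N e.1 e.2.
(* A natural number strictly above [B], as the initial utility is 0. *)
have [|||g [t [k [lg og t_le]]]] := @cancel_loop_terminates (Num.truncn B).+1 f0.
- exact: zero_flow_circulation.
- exact: zero_flow_integral.
- move=> g /utility_le g_le; rewrite zero_flow_utility add0r.
  by rewrite (le_lt_trans g_le) // truncnS_gt.
rewrite zero_flow_utility add0r => k_le.
exists g, ((zero_flow N).2 + t)%N, k; split=> //.
  by exists f0, (zero_flow N).2, t; split=> //; rewrite -surjective_pairing.
by rewrite leq_add ?zero_flow_steps.
Qed.

End CancelLoop.

(** * The running time in terms of the maximal capacity and utility *)

Lemma utility_le_max (R : realType) (V : finType) (N : network R V) (f : flow R V)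
    (Rbar Ubar : R) :
  is_circulation N f -> 0 <= Ubar ->
  (forall i j, (i, j) \in request N -> reqcap N i j <= Rbar) ->
  (forall i j, (i, j) \in request N -> util N i j <= Ubar) ->
  utility N f <= #|request N|%:R * (Rbar * Ubar).
Proof.
case=> _ _ fr _ U0 Rm Um; rewrite mulr_natl -sumr_const.
apply: ler_sum => -[i j] /= ij; have /andP[f0 f1] := fr _ _ ij.
(* Single utilities may be negative, so they are raised to [Ubar] first; only then is the flow
   raised to [Rbar], using [0 <= Ubar]. *)
rewrite (le_trans (ler_wpM2r f0 (Um _ _ ij))) // mulrC ler_wpM2r //.
exact: le_trans f1 (Rm _ _ ij).
Qed.

Theorem theorem3 (R : realType) (find : cycle_finder R)
    (find_correct : finder_correct find) (find_fast : finder_fast find) :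
  exists C : nat, forall (V : finType) (N : network R V) (K : nat),
    well_formed N ->
    on_data (fun x : R => is_rational x) N ->
    (0 < K)%N ->
    on_data (fun x : R => K%:R * x \is a Num.int) N ->
    exists (f : flow R V) (t : nat),
      [/\ scaled_cycle_canceling find K N f t,
          is_optimal N f &
          forall Rbar Ubar : R,
            is_maximum (request N) (reqcap N) Rbar ->
            is_maximum (request N) (util N) Ubar ->
            0 < Ubar ->
            t%:R <= C%:R * (#|V|%:R * #|request N|%:R
                            * (#|request N| + #|social N|)%:R
                            * Rbar * Ubar * K%:R ^+ 2)].
Proof.
(* The constant is 7 + 2 (b + 6): 7 for scaling, initialisation and division, b + 6 for a round, and
   2 from bounding [k.+1] by [2 * X] below. *)
have [b fast] := find_fast; exists (2 * b + 19)%N => V N K wfN _ K0 [intr ints].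
have K0R : 0 < K%:R :> R by rewrite ltr0n.
set N' := (scale_network K N).1.
have sN : scaled_network K%:R N N' by exact: scale_network_scaled.
have wfN' := scaled_well_formed K0R sN wfN.
have intN' : on_data (fun x : R => x \is a Num.int) N'.
  have [rE sE rx sx] := sN; split=> i j; rewrite ?rE ?sE => ij.
    by have [-> ->] := rx _ _ ij; exact: intr.
  by rewrite sx //; exact: ints.
have [g [t [k [ccg og t_le k_le]]]] :=
  cycle_canceling_terminates find_correct fast wfN' intN'.
exists (divide_flow K N g).1,
  ((scale_network K N).2 + t + (divide_flow K N g).2)%N.
have KV0 : 0 < K%:R^-1 :> R by rewrite invr_gt0.
split.
- exists N', (scale_network K N).2, g, t, (divide_flow K N g).2.
  by split=> //; rewrite -surjective_pairing.
- apply: (scaled_optimal KV0 wfN' (scaled_networkV _ sN) _ og).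
    by rewrite gt_eqF.
  exact: divide_flow_scaled.
move=> Rbar Ubar [[i [j [ij Rij]]] Rmax] [[i' [j' [ij' Uij]]] Umax] U0.
(* The maximum is attained, so [K%:R * Rbar] is a positive integer; likewise for [Ubar], which is
   assumed positive. *)
have R1 : 1 <= K%:R * Rbar.
  rewrite -Rij; apply: intr_ge1; first by case: (intr _ _ ij).
  by rewrite mulr_gt0 //; case: wfN => _ ->.
have U1 : 1 <= K%:R * Ubar.
  rewrite -Uij; apply: intr_ge1; first by case: (intr _ _ ij').
  by rewrite mulr_gt0 // Uij.
set r := #|request N|; set s := #|social N|; set v := #|V|.
have r1 : (1 <= r)%N by apply/card_gt0P; exists (i, j).
have v1 : (1 <= v)%N by apply/card_gt0P; exists i.
(* [X] bounds the utility in the scaled network, hence [k]. Being at least 1, it also absorbs the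
   additive terms. *)
set X : R := r%:R * ((K%:R * Rbar) * (K%:R * Ubar)).
have X1 : 1 <= X by apply: mulr_ege1; rewrite ?ler1n // mulr_ege1.
have kX : k%:R <= X.
  apply: le_trans k_le _; apply: utility_le_max; first by case: og.
  - exact: le_trans ler01 U1.
  - by move=> x y xy; have [_ _ /(_ _ _ xy)[-> _] _] := sN; rewrite ler_pM2l ?Rmax.
  - by move=> x y xy; have [_ _ /(_ _ _ xy)[_ ->] _] := sN; rewrite ler_pM2l ?Umax.
(* The 7 collects 4 from scaling, 2 from division and 1 from the zero flow, per edge. *)
have t_nat : ((scale_network K N).2 + t + (divide_flow K N g).2 <=
    7 * (v * (r + s)) + k.+1 * ((b + 6) * (v * (r + s))))%N.
  have := scale_network_steps K N; have := divide_flow_steps K N g.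
  rewrite -/r -/s -/v in t_le *.
  move: t_le; rewrite /N' /= -/r -/s -/v => t_le d_le s_le.
  have rs_le : (r + s <= v * (r + s))%N by rewrite leq_pmull.
  have v_le : (v <= v * (r + s))%N by rewrite leq_pmulr // addn_gt0 r1.
  have : (k.+1 * (b * (v * (s + r)) + 6 * v) <= k.+1 * ((b + 6) * (v * (r + s))))%N.
    by rewrite leq_mul2l /= mulnDl [(s + r)%N]addnC leq_add2l leq_mul2l.
  lia.
apply: (@le_trans _ _ ((2 * b + 19)%:R * ((v * (r + s))%:R * X))); last first.
  by rewrite /X natrM le_eqVlt; apply/orP; left; apply/eqP; ring.
have w0 : 0 <= (v * (r + s))%:R :> R by [].
move: t_nat; rewrite -(ler_nat R) => /le_trans; apply.
have : k.+1%:R <= 2 * X by rewrite -natr1; lra.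
rewrite natrD [(7 * _)%:R]natrM [(k.+1 * _)%:R]natrM [((b + 6) * _)%:R]natrM.
move: w0; set w : R := (v * (r + s))%:R => w0 k1.
have le1 : k.+1%:R * ((b + 6)%:R * w) <= 2 * X * ((b + 6)%:R * w).
  by rewrite ler_wpM2r // mulr_ge0.
have le2 : w <= w * X by rewrite ler_peMr.
apply: (le_trans (lerD (ler_wpM2l _ le2) le1)) => //.
rewrite !natrD; lra.
Qed.
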